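(* Let $\mathcal{A}$ be any acknowledgment-based deterministic distributed broadcast algorithm for a multiple-access channel with collision detection that consists of exactly $n=2$ nodes. Then there exists a window adversary with individual injection rates, of aggregate burstiness $2$ and aggregate injection rate $1$, against which $\mathcal{A}$ is unstable.
   Context: Channel. There are $n$ nodes with distinct names $1,\dots,n$; each node knows its name and $n$. Time is divided into synchronous rounds and all nodes start simultaneously. In each round each node performs, in this order: (1) it either transmits one message or pauses, as determined by its state; (2) it receives feedback from the channel; (3) packets may be injected into it; (4) it makes a deterministic state transition determined by its state at the end of the previous round, the packets injected into it in this round, and the feedback. A message may contain at most one packet (from the transmitting node's queue) and possibly control bits. If exactly one node transmits in a round, its message is heard by all nodes in this round; if no node transmits, the feedback is silence; if two or more nodes transmit, a collision occurs and nothing is heard. The channel is with collision detection if the feedback distinguishes silence from collision. Each node keeps its packets in a private queue of unbounded capacity; injected packets are enqueued in the round of injection, and a packet is discarded once it is heard. Packets are abstract markers whose contents do not affect the algorithm. The algorithm does not know any parameter of the adversary. Adversary. A window adversary with individual injection rates is given by a positive integer window size $w$ and non-negative integer shares $s_1,\dots,s_n$ with $\sum_{i=1}^n s_i\le w$; in any interval of $w$ contiguous rounds it may inject at most $s_i$ packets into node $i$, for each $i$. Its aggregate burstiness is $\delta=\sum_{i=1}^n s_i$ and its aggregate injection rate is $\rho=\delta/w$. Acknowledgment-based. An algorithm is acknowledgment-based when a node without packets to transmit stays in an initial state and a node resets its state to an initial state immediately after a successful transmission; thus the action of a given node when it begins processing a new packet is always the same, being determined by the initial state. Stability. An algorithm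 is stable in an execution if there is a finite upper bound on the sizes of all the queues in all rounds of this (infinite) execution. It is stable against an adversary if it is stable in each execution against this adversary, and otherwise it is unstable against the adversary. *)

(* Defs.v *)
From mathcomp Require Import all_boot all_order all_algebra.

Set Implicit Arguments.
Unset Strict Implicit.
Unset Printing Implicit Defensive.

Import GRing.Theory.

(* Packets are abstract markers, so a message only records whether it carries
   a packet. *)
Record message := Message { has_packet : bool; control_bits : seq bool }.

Inductive feedback := Silence | Collision | Heard of message.

(* A node's queue is kept outside its state: resetting the state must not
   destroy the queue.  The boolean argument of [act] and [transition] says whether
   the queue was nonempty at the beginning of the round; an algorithm that
   needs more information on its queue can keep it in its state.  The natural
   number argument of [transition] is the number of packets injected into the node
   in the round. *)
Record algorithm (n : nat) := Algorithm {
  state : Type;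
  init : 'I_n -> state;
  act : 'I_n -> state -> bool -> option message;
  transition : 'I_n -> state -> bool -> nat -> feedback -> state;
  act_empty : forall i s m, act i s false = Some m -> ~~ has_packet m }.

Arguments init {n} _ _.
Arguments act {n} _ _ _ _.
Arguments transition {n} _ _ _ _ _ _.

(* A node that transmits and hears a message hears its own one.  A node with an
   empty queue at the beginning of a round stays in its initial state in this
   round, whatever is injected, so that the first action for a new packet is
   that of the initial state. *)
Definition acknowledgment_based n (A : algorithm n) : Prop :=
  forall i : 'I_n,
    (forall k f, transition A i (init A i) false k f = init A i) /\
    (forall s m k, act A i s true = Some m -> has_packet m ->
       transition A i s true k (Heard m) = init A i).

Definition channel n (tx : 'I_n -> option message) : feedback :=
  match pmap tx (enum 'I_n) with
  | [::] => Silence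
  | [:: m] => Heard m
  | _ => Collision
  end.

(* Number of packets (0 or 1) that leave the queue of a node transmitting [t]
   under feedback [f]. *)
Definition delivered (t : option message) (f : feedback) : nat :=
  match t, f with
  | Some m, Heard _ => has_packet m
  | _, _ => 0
  end.

Record config n (A : algorithm n) := Config {
  node_state : 'I_n -> state A;
  queue_size : 'I_n -> nat }.

Definition start n (A : algorithm n) : config A := Config (init A) (fun=> 0).

Definition step n (A : algorithm n) (inj : 'I_n -> nat) (c : config A) :
    config A :=
  let busy i := 0 < queue_size c i in
  let tx i := act A i (node_state c i) (busy i) in
  let f := channel tx in
  Config (fun i => transition A i (node_state c i) (busy i) (inj i) f)
         (fun i => queue_size c i - delivered (tx i) f + inj i).

(* [inj t i] packets are injected into node [i] in round [t]; as the algorithm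
   is deterministic, this determines the execution.  [exec A inj t] is the
   configuration before round [t], the first round being round 0. *)
Fixpoint exec n (A : algorithm n) (inj : nat -> 'I_n -> nat) (t : nat) :
    config A :=
  if t is t'.+1 then step (inj t') (exec A inj t') else start A.

Definition stable_in n (A : algorithm n) (inj : nat -> 'I_n -> nat) : Prop :=
  exists B : nat, forall t i, queue_size (exec A inj t) i <= B.

Record window_adversary (n : nat) := WindowAdversary {
  window : nat;
  share : 'I_n -> nat;
  window_gt0 : 0 < window;
  share_le_window : \sum_(i < n) share i <= window }.

Definition admissible n (adv : window_adversary n)
    (inj : nat -> 'I_n -> nat) : Prop :=
  forall t i, \sum_(t <= r < t + window adv) inj r i <= share adv i.

Definition burstiness n (adv : window_adversary n) : nat :=
  \sum_(i < n) share adv i.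

Definition injection_rate n (adv : window_adversary n) : rat :=
  ((burstiness adv)%:Q / (window adv)%:Q)%R.

Definition stable_against n (A : algorithm n) (adv : window_adversary n) :
    Prop :=
  forall inj, admissible adv inj -> stable_in A inj.

Definition unstable_against n (A : algorithm n) (adv : window_adversary n) :
    Prop :=
  ~ stable_against A adv.

(* Main.v *)
Require Import Defs.
From mathcomp Require Import all_boot all_order all_algebra.
From mathcomp Require Import zify.

(** Every node starts a new packet in its initial state, and so does an idle
    node.  If some node [i] does not transmit in its first round with a
    nonempty queue, inject one packet per round into [i] only: after each
    delivery the node is back in its initial state and wastes a round.
    Otherwise inject one packet into each node in every second round.  If no
    round were wasted from some point on, a node in its initial state would keep
    transmitting until its queue is empty, losing one packet in two rounds; then
    the other node has to deliver, so that at the next injection both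
    nodes are in their initial states and collide.  As the injection rate is 1,
    each wasted round increases the total queue size for good. *)

Set Implicit Arguments.
Unset Strict Implicit.
Unset Printing Implicit Defensive.

Lemma unbounded_of_progress (P : nat -> Prop) (f : nat -> nat) (t0 : nat) :
  P t0 -> (forall t, P t -> exists2 t', P t' & f t < f t') ->
  forall B, exists2 t, P t & B <= f t.
Proof.
move=> Pt0 prog; elim=> [|B [t Pt leBf]]; first by exists t0.
by have [t' Pt' ltf] := prog t Pt; exists t' => //; apply: leq_ltn_trans ltf.
Qed.

(** Stated for any two distinct nodes, so that later arguments can swap their roles. *)
Lemma channel2 (tx : 'I_2 -> option message) (i j : 'I_2) : i != j ->
  channel tx = match tx i, tx j with
               | None, None => Silence
               | Some m, None | None, Some m => Heard m
               | Some _, Some _ => Collision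
               end.
Proof.
have -> : channel tx = match tx ord0, tx ord_max with
               | None, None => Silence
               | Some m, None | None, Some m => Heard m
               | Some _, Some _ => Collision
               end.
  rewrite /channel enum_ordSl enum_ordSl /= (_ : lift ord0 ord0 = ord_max).
    have -> : enum 'I_0 = [::] by apply: size0nil; rewrite size_enum_ord.
    by case: (tx ord0) => [?|]; case: (tx ord_max).
  exact: val_inj.
have two (k : 'I_2) : k = ord0 \/ k = ord_max.
  by case: k => [[|[|]]] // ltk; [left | right]; apply: val_inj.
case: (two i) => ->; case: (two j) => -> //= _.
by case: (tx ord0) => [?|]; case: (tx ord_max).
Qed.

Lemma delivered_le1 (tx : option message) (f : feedback) : delivered tx f <= 1.
Proof. by case: tx f => [m|] [||h] //=; case: has_packet. Qed.

Section Execution.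

Variables (A : algorithm 2) (inj : nat -> 'I_2 -> nat).
Hypothesis hA : acknowledgment_based A.

Let state_at t i := node_state (exec A inj t) i.
Let queue t i := queue_size (exec A inj t) i.
Let tx t i := act A i (state_at t i) (0 < queue t i).
Let sent t i := delivered (tx t i) (channel (tx t)).

Lemma queueS t i : queue t.+1 i = queue t i - sent t i + inj t i.
Proof. by []. Qed.

(** Makes the truncated subtraction in [queueS] exact: by [act_empty], a node with an empty queue
    sends no packet. *)
Lemma sent_le_queue t i : sent t i <= queue t i.
Proof.
case: (posnP (queue t i)) => [q0|]; last exact/leq_trans/delivered_le1.
rewrite /sent; case E: (tx t i) => [m|] //=.
move: E; rewrite /tx q0 => /act_empty/negbTE ->.
by case: channel.
Qed.

Lemma sent_init t i : 0 < sent t i -> state_at t.+1 i = init A i.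
Proof.
move=> s_gt0; have q_gt0 := leq_trans s_gt0 (sent_le_queue t i).
have st : state_at t.+1 i = transition A i (state_at t i) (0 < queue t i)
    (inj t i) (channel (tx t)) by [].
have [j ij] : exists j, i != j by exists (rev_ord i); case: i {s_gt0 q_gt0 st} => [[|[|]]].
move: s_gt0; rewrite /sent st (channel2 _ ij) q_gt0.
case E: (tx t i) => [m|] //=; case: (tx t j) => [//|]; rewrite lt0b => pm.
by have [_ ->] := hA i; last exact: pm; move: E; rewrite /tx q_gt0.
Qed.

Lemma empty_stays_init t i :
  state_at t i = init A i -> queue t i = 0 -> state_at t.+1 i = init A i.
Proof.
move=> st q0; have [idle _] := hA i.
rewrite -[RHS](idle (inj t i) (channel (tx t))) -st.
by rewrite (_ : false = (0 < queue t i)) // q0.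
Qed.

Lemma empty_init t i : queue t i = 0 -> state_at t i = init A i.
Proof.
elim: t => [//|t IHt] q0; case: (posnP (queue t i)) => [qt0|qt_gt0].
  by apply: empty_stays_init => //; apply: IHt.
by apply: sent_init; move: q0; rewrite queueS; lia.
Qed.

Lemma lazy_start_unstable (i : 'I_2) :
  act A i (init A i) true = None ->
  (forall t, inj t i = 1) -> ~ stable_in A inj.
Proof.
move=> lazy inj1 [B bnd].
have grow t : queue t.+1 i = queue t i - sent t i + 1 by rewrite queueS inj1.
suff prog t : 0 < t -> exists2 t', 0 < t' & queue t i < queue t' i.
  have [t _] := @unbounded_of_progress (leq 1) (queue^~ i) 1 erefl prog B.+1.
  by rewrite ltnNge bnd.
move=> _; case: (posnP (sent t i)) => [s0|s_gt0].
  by exists t.+1; rewrite // grow s0; lia.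
exists t.+2 => //.
(* The node is back in its initial state with a nonempty queue, so it pauses: two injections against
   one delivery. *)
have s0 : sent t.+1 i = 0.
  by rewrite /sent /tx (sent_init s_gt0) grow addn1 lazy.
rewrite grow s0 grow.
by have := sent_le_queue t i; have := delivered_le1 (tx t i) (channel (tx t));
  rewrite -/(sent t i); lia.
Qed.

Lemma sent_sum_le1 t i j : i != j -> sent t i + sent t j <= 1.
Proof.
move=> ij; rewrite /sent (channel2 _ ij).
case: (tx t i) => [m|]; case: (tx t j) => [m'|] //=.
  by rewrite addn0 leq_b1.
by rewrite leq_b1.
Qed.

Section EagerStart.

Hypothesis eager : forall i, act A i (init A i) true.
Hypothesis inj_even : forall t i, inj t i = ~~ odd t.

(** Node [i] certainly transmits, so [j] either pauses or collides. *)
Lemma eager_sole_sender t i j : i != j -> state_at t i = init A i ->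
  0 < queue t i -> sent t j = 0.
Proof.
move=> ij st q_gt0; rewrite /sent (channel2 _ ij).
have : tx t i by rewrite /tx q_gt0 st eager.
by case: (tx t i) => [m|//] _; case: (tx t j).
Qed.

(** An odd [t] marks a configuration right after an injection; the argument proceeds in blocks of
    two rounds from there. *)
Lemma odd_queue_gt0 t i : odd t -> 0 < queue t i.
Proof. by case: t => // t /= ev; rewrite queueS inj_even ev addn1. Qed.

Lemma queue2 t i : odd t ->
  queue t.+2 i + sent t i + sent t.+1 i = (queue t i).+1.
Proof.
move=> ot; have := sent_le_queue t i; have := sent_le_queue t.+1 i.
by rewrite !queueS !inj_even /= ot; lia.
Qed.

Let total i j t := queue t i + queue t j.

(** A block brings in two packets, and each of its rounds removes at most one. *)
Lemma wasted_round t i j : i != j -> odd t ->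
  sent t i + sent t j = 0 \/ sent t.+1 i + sent t.+1 j = 0 ->
  total i j t < total i j t.+2.
Proof.
move=> ij ot; have := queue2 i ot; have := queue2 j ot.
by have := sent_sum_le1 t ij; have := sent_sum_le1 t.+1 ij; rewrite /total; lia.
Qed.

Lemma total_mono t i j : i != j -> odd t -> total i j t <= total i j t.+2.
Proof.
move=> ij ot; have := queue2 i ot; have := queue2 j ot.
by have := sent_sum_le1 t ij; have := sent_sum_le1 t.+1 ij; rewrite /total; lia.
Qed.

(** If packets remain after the delivery, [i] transmits again and blocks [j]: either [i] delivers or
    the round is wasted. *)
Lemma sent_init2 t i j : i != j -> odd t -> 0 < sent t i ->
  total i j t < total i j t.+2 \/ state_at t.+2 i = init A i.
Proof.
move=> ij ot s_gt0; have st := sent_init s_gt0.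
case: (posnP (queue t.+1 i)) => [q0|q_gt0].
  by right; apply: empty_stays_init.
case: (posnP (sent t.+1 i)) => [s0|]; last by right; apply: sent_init.
left; apply: wasted_round => //; right.
by rewrite s0 (eager_sole_sender ij st q_gt0).
Qed.

(** Induction on a bound for the queue of [i], which shrinks by one in a block where [i] delivers
    twice. *)
Lemma init_progress k t i j : i != j -> odd t -> state_at t i = init A i ->
  queue t i <= k -> exists2 t', odd t' & total i j t < total i j t'.
Proof.
elim: k t => [|k IHk] t ij ot st qk.
  by have := odd_queue_gt0 i ot; lia.
have sj := eager_sole_sender ij st (odd_queue_gt0 i ot).
have ot2 : odd t.+2 by rewrite /= negbK.
case: (posnP (sent t i)) => [s0|s_gt0].
  by exists t.+2 => //; apply: wasted_round => //; left; rewrite s0 sj.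
case: (posnP (sent t.+1 i + sent t.+1 j)) => [s0|s'_gt0].
  by exists t.+2 => //; apply: wasted_round => //; right.
have st1 := sent_init s_gt0; have mono := total_mono ij ot.
case: (posnP (queue t.+1 i)) => [q0|q_gt0]; last first.
  have sj1 := eager_sole_sender ij st1 q_gt0.
  have [||t' ot' lt'] := IHk t.+2 ij ot2.
  - by apply: sent_init; move: s'_gt0; rewrite sj1 addn0.
  - by have := queue2 i ot; lia.
  by exists t' => //; apply: leq_ltn_trans lt'.
(* Now [i] has run empty, so the delivery in round [t.+1] is by [j], and both nodes are in their
   initial states before round [t.+2]. *)
have sti := empty_stays_init st1 q0.
have stj : state_at t.+2 j = init A j.
  by apply: sent_init; have := sent_le_queue t.+1 i; lia.
(* The collision in round [t.+2] wastes a round of the next block. *)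
exists t.+4; first by rewrite /= !negbK.
apply: leq_ltn_trans mono _; apply: wasted_round => //; left.
rewrite (eager_sole_sender ij sti (odd_queue_gt0 i ot2)) addn0.
by rewrite eq_sym in ij; apply: eager_sole_sender ij stj (odd_queue_gt0 j ot2).
Qed.

Lemma eager_start_unstable : ~ stable_in A inj.
Proof.
move=> [B bnd]; pose i0 : 'I_2 := ord0; pose j0 : 'I_2 := ord_max.
have prog t : odd t -> exists2 t', odd t' & total i0 j0 t < total i0 j0 t'.
  move=> ot; have ot2 : odd t.+2 by rewrite /= negbK.
  have after i j : i != j -> 0 < sent t i ->
      exists2 t', odd t' & total i j t < total i j t'.
    move=> ij /(sent_init2 ij ot) [lt2|st]; first by exists t.+2.
    have [t' ot' lt'] := init_progress ij ot2 st (leqnn _).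
    by exists t' => //; apply: leq_ltn_trans (total_mono ij ot) lt'.
  have [s_gt0|si] := posnP (sent t i0); last exact: after.
  have [s'_gt0|sj] := posnP (sent t j0); last first.
    have [|t' ot' lt'] := @after j0 i0 _ sj; first by [].
    by exists t' => //; rewrite /total ![queue _ i0 + _]addnC.
  by exists t.+2 => //; apply: wasted_round => //; left; rewrite s_gt0 s'_gt0.
have [t _] := @unbounded_of_progress odd (total i0 j0) 1 erefl prog (B + B).+1.
by rewrite ltnNge leq_add // bnd.
Qed.

End EagerStart.

End Execution.

Lemma unit_rate (adv : window_adversary 2) :
  window adv = 2 -> burstiness adv = 2 -> injection_rate adv = 1%R.
Proof. by rewrite /injection_rate => -> ->. Qed.

Theorem theorem1 (A : algorithm 2) (hA : acknowledgment_based A) :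
  exists adv : window_adversary 2,
    burstiness adv = 2 /\ injection_rate adv = 1%R /\ unstable_against A adv.
Proof.
case: (boolP [forall i, act A i (init A i) true : bool])
  => [/forallP eager|/forallPn [i lazy]].
  have sum1 : \sum_(i < 2) 1 = 2 by rewrite sum1_card card_ord.
  have le1 : \sum_(i < 2) 1 <= 2 by rewrite sum1.
  exists (@WindowAdversary 2 2 (fun=> 1) isT le1).
  split=> //; split; first exact: unit_rate.
  move=> /(_ (fun t _ => ~~ odd t)) stab.
  apply: (@eager_start_unstable A (fun t _ => ~~ odd t)) => //.
  (* Two consecutive rounds contain exactly one even round. *)
  apply: stab => t i /=; rewrite addn2 big_nat_recl // big_nat1 /=.
  by case: odd.
have sum2 : \sum_(k < 2) (if k == i then 2 else 0) = 2.
  by rewrite -big_mkcond big_pred1_eq.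
have le2 : \sum_(k < 2) (if k == i then 2 else 0) <= 2 by rewrite sum2.
exists (@WindowAdversary 2 2 (fun k => if k == i then 2 else 0) isT le2).
split=> //; split; first exact: unit_rate.
move=> /(_ (fun _ k => k == i)) stab.
apply: (@lazy_start_unstable A (fun _ k => k == i) hA i) => //.
- by move: lazy; case: act.
- by move=> t; rewrite eqxx.
apply: stab => t k /=; rewrite sum_nat_const_nat addKn.
by case: eqP.
Qed.
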